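(* Let $\mathcal{A}$ be a real symmetric tensor of order $m$ and dimension $n$. Then $\mathcal{A}$ is copositive if and only if every principal sub-tensor of $\mathcal{A}$ has no negative $Z^{++}$-eigenvalue, i.e., no principal sub-tensor of $\mathcal{A}$ has a ($Z$-)eigenvector $v>0$ with associated $Z$-eigenvalue $\lambda<0$.
   Context: Let $m,n$ be positive integers. A real tensor of order $m$ and dimension $n$ is an array $\mathcal{A}=(a_{i_1\cdots i_m})$ with $a_{i_1\cdots i_m}\in\mathbb{R}$, $1\le i_1,\dots,i_m\le n$. It is symmetric if its entries are invariant under every permutation of the indices. For $x\in\mathbb{R}^n$, $\mathcal{A}x^{m-1}\in\mathbb{R}^n$ is the vector with $i$-th component $\sum_{i_2,\dots,i_m=1}^n a_{ii_2\cdots i_m}x_{i_2}\cdots x_{i_m}$, and $\mathcal{A}x^m=x^T(\mathcal{A}x^{m-1})=\sum_{i_1,\dots,i_m=1}^n a_{i_1\cdots i_m}x_{i_1}\cdots x_{i_m}$. For a real vector $x$, $x\ge 0$ (resp. $x>0$) means all components are $\ge 0$ (resp. $>0$); $\mathbb{R}^n_+=\{x\in\mathbb{R}^n: x\ge 0\}$ and $\mathbb{R}^n_{++}=\{x\in\mathbb{R}^n: x>0\}$. $\mathcal{A}$ is copositive if $\mathcal{A}x^m\ge 0$ for all $x\in\mathbb{R}^n_+$. For $1\le r\le n$ and a set $\mathcal{N}\subseteq\{1,\dots,n\}$ with $r$ elements, the array $\mathcal{B}=(a_{i_1\cdots i_m})_{i_1,\dots,i_m\in\mathcal{N}}$ is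 an order $m$, dimension $r$ principal sub-tensor of $\mathcal{A}$ (the case $\mathcal{N}=\{1,\dots,n\}$, giving $\mathcal{A}$ itself, is included). For a tensor $\mathcal{B}$ of order $m$ and dimension $r$, a real number $\mu$ is a $Z$-eigenvalue with $Z$-eigenvector $x\in\mathbb{R}^r$ if $\mathcal{B}x^{m-1}=\mu x$ and $x^Tx=1$. It is a $Z^{++}$-eigenvalue of $\mathcal{B}$ if it has a $Z$-eigenvector in $\mathbb{R}^r_{++}$. *)

(* Defs.v *)
From HB Require Import structures.
From mathcomp Require Import all_boot all_order all_algebra all_fingroup.
From mathcomp Require Import reals.

Set Implicit Arguments.
Unset Strict Implicit.
Unset Printing Implicit Defensive.

Import Order.TTheory GRing.Theory Num.Theory.
Local Open Scope ring_scope.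

Definition tensor (R : realType) (m n : nat) := {ffun m.-tuple 'I_n -> R}.

Definition symmetric_tensor (R : realType) (m n : nat) (A : tensor R m n) :=
  forall (s : 'S_m) (t : m.-tuple 'I_n), A [tuple tnth t (s k) | k < m] = A t.

(* The vector A x^{m-1} for a tensor of order m; positivity of the order is
   encoded by writing it as a successor. *)
Definition tensor_app (R : realType) (m n : nat) (A : tensor R m.+1 n)
    (x : 'cV[R]_n) : 'cV[R]_n :=
  \col_i \sum_(t : m.-tuple 'I_n) A [tuple of i :: t] *
    \prod_(k < m) x (tnth t k) 0.

(* The scalar A x^m. *)
Definition tensor_form (R : realType) (m n : nat) (A : tensor R m n)
    (x : 'cV[R]_n) : R :=
  \sum_(t : m.-tuple 'I_n) A t * \prod_(k < m) x (tnth t k) 0.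

Definition copositive (R : realType) (m n : nat) (A : tensor R m n) :=
  forall x : 'cV[R]_n, (forall i, 0 <= x i 0) -> 0 <= tensor_form A x.

(* The elements of N are relabelled 0, ..., #|N| - 1 in increasing order. *)
Definition principal_subtensor (R : realType) (m n : nat) (A : tensor R m n)
    (N : {set 'I_n}) : tensor R m #|N| :=
  [ffun t : m.-tuple 'I_#|N| => A [tuple of [seq enum_val k | k <- t]]].

Definition Z_eigenpair (R : realType) (m r : nat) (B : tensor R m.+1 r)
    (mu : R) (x : 'cV[R]_r) :=
  tensor_app B x = mu *: x /\ (x^T *m x) 0 0 = 1.

Definition Zpp_eigenvalue (R : realType) (m r : nat) (B : tensor R m.+1 r)
    (mu : R) :=
  exists x : 'cV[R]_r, (forall i, 0 < x i 0) /\ Z_eigenpair B mu x.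

(* Main.v *)
(** If [A] takes a negative value on the nonnegative orthant, let [x] minimise
    [A x^m] over the nonnegative part of the unit sphere, with value [mu < 0],
    and let [N] be the support of [x]. Moving [x] in any direction [v] supported
    in [N] and orthogonal to [x] stays in the orthant for a short time, so by
    homogeneity [A (x + t v)^m - mu (1 + t^2 |v|^2)^m] is a polynomial in [t]
    with a local minimum at [0]. Its derivative there is a multiple of
    [v . A x^(m-1)], which therefore vanishes; hence [A x^(m-1)] equals [mu x]
    on [N]. Conversely, extending a positive eigenvector of a principal
    sub-tensor by zero gives a nonnegative [x] with [A x^m = mu]. *)

(* Imported first, so that [set0] below is that of finset. *)
From mathcomp Require Import boolp classical_sets topology normedtype derive.
Require Import Defs.
From mathcomp Require Import all_boot all_order all_algebra all_fingroup.
From mathcomp Require Import ring lra.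
From mathcomp Require Import reals.

Import Order.TTheory GRing.Theory Num.Theory.
Import numFieldNormedType.Exports.
Local Open Scope ring_scope.

Set Implicit Arguments.
Unset Strict Implicit.
Unset Printing Implicit Defensive.

(** * Derivatives of real polynomials *)

Lemma deriv_prod (R : comNzRingType) (m : nat) (F : 'I_m -> {poly R}) :
  (\prod_k F k)^`() = \sum_k (F k)^`() * \prod_(j | j != k) F j.
Proof.
elim: m F => [|m IH] F; first by rewrite !big_ord0 -polyC1 derivC.
rewrite big_ord_recl derivM IH [RHS]big_ord_recl; congr (_ * _ + _).
  by rewrite [RHS]big_mkcond big_ord_recl /= mul1r.
rewrite big_distrr; apply: eq_bigr => k _ /=.
rewrite mulrCA; congr (_ * _).
rewrite [RHS]big_mkcond big_ord_recl /= [X in _ * X = _]big_mkcond.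
by congr (_ * _); apply: eq_bigr => j _; rewrite (inj_eq lift_inj).
Qed.

(** Fermat's criterion, transferred from the analytic derivative of [horner p] to the formal
    derivative of [p]. *)
Lemma deriv_horner_local_min (R : realType) (p : {poly R}) (e a : R) :
  0 < e -> (forall t, `|t - a| < e -> p.[a] <= p.[t]) -> p^`().[a] = 0.
Proof.
move=> e0 pmin.
have H : is_derive a 1 (horner p) 0.
  apply: (@derive1_at_min R _ (a - e) (a + e)).
  - by lra.
  - by move=> t _; exact: derivable_horner.
  - by rewrite in_itv /=; apply/andP; split; lra.
  - move=> t; rewrite in_itv /= => /andP[t1 t2]; apply: pmin.
    by rewrite ltr_norml; apply/andP; split; lra.
have H' := is_derive_poly p a.
by rewrite -(@derive_val _ _ _ _ _ _ _ H') (@derive_val _ _ _ _ _ _ _ H).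
Qed.

(** * Forms of tensors and their restriction to a line *)

Lemma big_tuple_cons (R : nmodType) (T : finType) (m : nat)
    (F : m.+1.-tuple T -> R) :
  \sum_t F t = \sum_i \sum_(t : m.-tuple T) F [tuple of i :: t].
Proof.
rewrite pair_bigA /= (reindex (fun p : T * m.-tuple T => [tuple of p.1 :: p.2])) //=.
exists (fun t : m.+1.-tuple T => (thead t, [tuple of behead t])).
  by case=> i t _ /=; rewrite theadE; congr pair; apply: val_inj.
by move=> t _ /=; rewrite -tuple_eta.
Qed.

Lemma tensor_formE (R : realType) (m n : nat) (A : tensor R m.+1 n)
    (x : 'cV[R]_n) :
  tensor_form A x = \sum_i x i 0 * tensor_app A x i 0.
Proof.
rewrite /tensor_form big_tuple_cons; apply: eq_bigr => i _.
rewrite mxE big_distrr; apply: eq_bigr => t _ /=.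
rewrite big_ord_recl tnth0 mulrCA; congr (_ * (_ * _)).
by apply: eq_bigr => k _; rewrite tnthS.
Qed.

Lemma tensor_formZ (R : realType) (m n : nat) (A : tensor R m n)
    (c : R) (x : 'cV[R]_n) :
  tensor_form A (c *: x) = c ^+ m * tensor_form A x.
Proof.
rewrite /tensor_form big_distrr; apply: eq_bigr => t _ /=.
under eq_bigr do rewrite mxE.
by rewrite big_split /= prodr_const card_ord mulrCA.
Qed.

(** The form along a line is kept as a formal polynomial, so that differentiating it is pure
    algebra. *)
Definition line_poly (R : realType) (m n : nat) (A : tensor R m n)
    (x v : 'cV[R]_n) : {poly R} :=
  \sum_(t : m.-tuple 'I_n) (A t)%:P *
    \prod_(k < m) ((x (tnth t k) 0)%:P + (v (tnth t k) 0)%:P * 'X).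

Lemma horner_line_poly (R : realType) (m n : nat) (A : tensor R m n)
    (x v : 'cV[R]_n) (s : R) :
  (line_poly A x v).[s] = tensor_form A (x + s *: v).
Proof.
rewrite /line_poly horner_sum; apply: eq_bigr => t _.
rewrite hornerM hornerC horner_prod; congr (_ * _); apply: eq_bigr => k _.
by rewrite !hornerE !mxE mulrC.
Qed.

(* By symmetry of [A], each of the [m.+1] factors contributes the same amount
   to the derivative. *)
Lemma deriv_line_poly (R : realType) (m n : nat) (A : tensor R m.+1 n)
    (x v : 'cV[R]_n) : symmetric_tensor A ->
  (line_poly A x v)^`().[0] = (\sum_i v i 0 * tensor_app A x i 0) *+ m.+1.
Proof.
move=> symA.
(* [G k] is the part of the derivative at 0 in which the factor at position [k] is
   differentiated. *)
pose G (k : 'I_m.+1) := \sum_(t : m.+1.-tuple 'I_n) A t *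
  (v (tnth t k) 0 * \prod_(j | j != k) x (tnth t j) 0).
have GE k : G k = G ord0.
  (* Reindexing by [h], which swaps the entries at positions 0 and [k], turns [G k] into
     [G ord0]. *)
  rewrite /G; pose s : 'S_m.+1 := tperm ord0 k.
  pose h (t : m.+1.-tuple 'I_n) := [tuple tnth t (s j) | j < m.+1].
  have hK : involutive h.
    by move=> t; apply: eq_from_tnth => j; rewrite !tnth_mktuple tpermK.
  rewrite (reindex_inj (inv_inj hK)) /=; apply: eq_bigr => t _.
  rewrite symA tnth_mktuple tpermR; congr (_ * (_ * _)).
  rewrite [RHS](reindex_inj (@perm_inj _ s)) /=; apply: eq_big => j.
    by rewrite -(inj_eq (@perm_inj _ s)) tpermR.
  by move=> _; rewrite tnth_mktuple.
transitivity (\sum_k G k).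
  rewrite /G exchange_big /line_poly raddf_sum horner_sum.
  apply: eq_bigr => t _ /=.
  rewrite derivM derivC mul0r add0r hornerM hornerC -big_distrr /=.
  congr (_ * _); rewrite deriv_prod horner_sum; apply: eq_bigr => k _.
  rewrite hornerM derivD derivC add0r derivM derivC mul0r add0r derivX mulr1 hornerC.
  rewrite horner_prod; congr (_ * _); apply: eq_bigr => j _.
  by rewrite !hornerE.
rewrite (eq_bigr _ (fun k _ => GE k)) sumr_const card_ord; congr (_ *+ _).
rewrite /G big_tuple_cons; apply: eq_bigr => i _.
rewrite mxE big_distrr; apply: eq_bigr => t _ /=.
rewrite tnth0 mulrCA; congr (_ * (_ * _)).
rewrite big_mkcond big_ord_recl /= mul1r.
by apply: eq_bigr => k _; rewrite tnthS.
Qed.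

(** * Squared norms and principal sub-tensors *)

Lemma sqnormE (R : realType) (n : nat) (x : 'cV[R]_n) :
  (x^T *m x) 0 0 = \sum_i x i 0 ^+ 2.
Proof. by rewrite mxE; apply: eq_bigr => i _; rewrite mxE expr2. Qed.

Lemma sqnormZ (R : realType) (n : nat) (c : R) (x : 'cV[R]_n) :
  ((c *: x)^T *m (c *: x)) 0 0 = c ^+ 2 * (x^T *m x) 0 0.
Proof.
rewrite !sqnormE big_distrr; apply: eq_bigr => i _.
by rewrite mxE exprMn.
Qed.

Lemma big_tuple_enum_val (R : nmodType) (n : nat) (N : {set 'I_n}) (m : nat)
    (F : m.-tuple 'I_n -> R) :
  (forall t k, tnth t k \notin N -> F t = 0) ->
  \sum_t F t = \sum_(t : m.-tuple 'I_#|N|) F [tuple of [seq enum_val k | k <- t]].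
Proof.
move=> F0; pose h (t : m.-tuple 'I_#|N|) := [tuple of [seq enum_val k | k <- t]].
rewrite (bigID (mem [set h t | t : m.-tuple 'I_#|N|])) /= [X in _ + X]big1 ?addr0.
  rewrite big_imset //= => s t _ _ /(congr1 val) /=.
  by move/(inj_map enum_val_inj)/val_inj.
move=> t tN; have [tP|] := boolP [forall k, tnth t k \in N].
  (* The empty tuple is treated apart because [N] may then be empty. Otherwise entry 0 of [t]
     supplies the element of [N] that [enum_rank_in] requires. *)
  case/imsetP: tN; case: m F F0 @h t tP => [|m] F F0 h t tP.
    by exists [tuple]; rewrite // [LHS]tuple0 [RHS]tuple0.
  have t0 := forallP tP ord0.
  exists [tuple of [seq enum_rank_in t0 k | k <- t]] => //.
  apply: eq_from_tnth => k; rewrite /h !tnth_map enum_rankK_in //.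
  exact: (forallP tP).
by rewrite negb_forall => /existsP[k /F0].
Qed.

Definition restrict_vec (R : realType) (n : nat) (N : {set 'I_n})
    (x : 'cV[R]_n) : 'cV[R]_#|N| := \col_i x (enum_val i) 0.

(** Extension by zero. At most one summand is nonzero because [enum_val] is injective; the sum
    avoids inverting [enum_val], which would need an element of [N]. *)
Definition extend_vec (R : realType) (n : nat) (N : {set 'I_n})
    (v : 'cV[R]_#|N|) : 'cV[R]_n := \col_j \sum_i v i 0 *+ (enum_val i == j).

Lemma extend_vec_out (R : realType) (n : nat) (N : {set 'I_n})
    (v : 'cV[R]_#|N|) j : j \notin N -> extend_vec v j 0 = 0.
Proof.
move=> jN; rewrite mxE big1 // => i _.
by case: eqP jN => // <-; rewrite enum_valP.
Qed.

Lemma extend_vecK (R : realType) (n : nat) (N : {set 'I_n}) :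
  cancel (@extend_vec R n N) (@restrict_vec R n N).
Proof.
move=> v; apply/colP => i; rewrite !mxE (bigD1 i) //= eqxx big1 ?addr0 // => j ji.
by rewrite (inj_eq enum_val_inj) (negbTE ji).
Qed.

(** Every term with a summation index outside [N] contains a zero coordinate of [x], so only tuples
    over [N] contribute. *)
Lemma tensor_app_restrict (R : realType) (m n : nat) (A : tensor R m.+1 n)
    (N : {set 'I_n}) (x : 'cV[R]_n) :
  (forall j, j \notin N -> x j 0 = 0) ->
  tensor_app (principal_subtensor A N) (restrict_vec N x) =
  restrict_vec N (tensor_app A x).
Proof.
move=> x0; apply/colP => i; rewrite !mxE (@big_tuple_enum_val _ _ N).
  apply: eq_bigr => t _; rewrite ffunE; congr (_ * _).
    by congr (A _); apply: val_inj.
  by apply: eq_bigr => k _; rewrite mxE tnth_map.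
by move=> t k /x0 xk; rewrite (bigD1 k) //= xk mul0r mulr0.
Qed.

Lemma sqnorm_restrict (R : realType) (n : nat) (N : {set 'I_n}) (x : 'cV[R]_n) :
  (forall j, j \notin N -> x j 0 = 0) ->
  ((restrict_vec N x)^T *m restrict_vec N x) 0 0 = (x^T *m x) 0 0.
Proof.
move=> x0; rewrite !sqnormE [RHS](bigID (mem N)) /= [X in _ = _ + X]big1.
  by rewrite addr0 [RHS]big_enum_val; apply: eq_bigr => i _; rewrite mxE.
by move=> i /x0 ->; rewrite expr0n.
Qed.

Lemma sum_restrict (R : realType) (n : nat) (N : {set 'I_n}) (x y : 'cV[R]_n) :
  (forall j, j \notin N -> x j 0 = 0) ->
  \sum_i x i 0 * y i 0 = \sum_i restrict_vec N x i 0 * restrict_vec N y i 0.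
Proof.
move=> x0; rewrite [LHS](bigID (mem N)) /= [X in _ + X]big1.
  by rewrite addr0 [LHS]big_enum_val; apply: eq_bigr => i _; rewrite !mxE.
by move=> i /x0 ->; rewrite mul0r.
Qed.

(** * Small steps and minimisation in the nonnegative orthant *)

Lemma pos_radius (R : realType) (n : nat) (x v : 'cV[R]_n) :
  (forall i, 0 <= x i 0) -> (forall i, x i 0 = 0 -> v i 0 = 0) ->
  exists2 e, 0 < e & forall t, `|t| < e -> forall i, 0 <= (x + t *: v) i 0.
Proof.
move=> x_ge0 v0.
(* The [+ 1] keeps the denominator positive when [v i 0 = 0]. Coordinates with [x i 0 = 0] do not
   move, so any positive value serves there. *)
pose f i := if x i 0 == 0 then 1 else x i 0 / (`|v i 0| + 1).
exists (\big[Num.min/1]_i f i).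
  elim/big_ind: _ => //= [a b a0 b0|i _]; first by rewrite lt_min a0.
  rewrite /f; case: eqP => // /eqP xi; rewrite divr_gt0 ?lt0r ?xi //=.
  by rewrite addr_ge0 // andbT gt_eqF // ltr_wpDl.
move=> t te i; rewrite !mxE; have [xi|xi] := eqVneq (x i 0) 0.
  by rewrite xi (v0 i xi) mulr0 addr0.
have : `|t| < f i by apply: lt_le_trans te _; exact: bigmin_le_cond.
rewrite /f (negbTE xi) ltr_pdivlMr ?ltr_wpDl // => tx.
have : `|t * v i 0| <= x i 0.
  rewrite normrM; apply: le_trans (ltW tx); apply: ler_wpM2l => //; lra.
by rewrite ler_norml => /andP[]; lra.
Qed.

Lemma continuous_tensor_form (R : realType) (m n : nat) (A : tensor R m n) :
  continuous (fun x : 'rV[R]_n => tensor_form A x^T).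
Proof.
apply: continuous_big => [|t _]; first exact: add_continuous.
move=> x; apply: (@continuousM R 'rV[R]_n (fun=> A t)); first exact: cst_continuous.
move: x; apply: continuous_big => [|k _]; first exact: mul_continuous.
by under eq_fun do rewrite mxE; exact: coord_continuous.
Qed.

(** The set is closed and lies in the cube with sides [[0, 1]], since each squared coordinate is at
    most the sum 1. *)
Lemma orthant_sphere_compact (R : realType) (n : nat) :
  compact [set x : 'rV[R]_n | (forall i, 0 <= x 0 i) /\
    \sum_i x 0 i ^+ 2 = 1]%classic.
Proof.
apply: (@subclosed_compact _ _ [set x : 'rV[R]_n | forall i,
  (`[0, 1]%classic : set R) (x ord0 i)]%classic).
- have -> : [set x : 'rV[R]_n | (forall i, 0 <= x 0 i) /\
      \sum_i x 0 i ^+ 2 = 1]%classic =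
    ((\bigcap_(i in [set: 'I_n]) ((fun x : 'rV[R]_n => x 0 i) @^-1` [set y | 0 <= y])) `&`
    ((fun x : 'rV[R]_n => \sum_i x 0 i ^+ 2) @^-1` [set 1]))%classic.
    apply/seteqP; split => x [x0 x1]; split => //= i; first by move=> _; exact: x0.
    exact: x0.
  apply: closedI.
    apply: closed_bigI => i _; apply: preimage_closed; last exact: closed_ge.
    by move=> x _; exact: coord_continuous.
  apply: preimage_closed; last exact: closed_eq.
  move=> x _; move: x; apply: continuous_big => [|k _]; first exact: add_continuous.
  by move=> x; apply: (@continuousM R 'rV[R]_n); exact: coord_continuous.
- by apply: (@rV_compact R n (fun=> `[0, 1]%classic)) => i; exact: segment_compact.
- move=> x [x0 x1] i /=; rewrite in_itv /= x0 /=.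
  rewrite -(@expr_le1 _ 2) // -x1 (bigD1 i) //= lerDl.
  by apply: sumr_ge0 => j _; exact: sqr_ge0.
Qed.

(** The point [y] makes the compact set nonempty, so the extreme value theorem applies. *)
Lemma tensor_form_min (R : realType) (m n : nat) (A : tensor R m n)
    (y : 'cV[R]_n) :
  (forall i, 0 <= y i 0) -> (y^T *m y) 0 0 = 1 ->
  exists x : 'cV[R]_n, [/\ forall i, 0 <= x i 0, (x^T *m x) 0 0 = 1 &
    forall z : 'cV[R]_n, (forall i, 0 <= z i 0) -> (z^T *m z) 0 0 = 1 ->
      tensor_form A x <= tensor_form A z].
Proof.
move=> y0 y1.
pose K := [set x : 'rV[R]_n | (forall i, 0 <= x 0 i) /\
    \sum_i x 0 i ^+ 2 = 1]%classic.
have KT (z : 'cV[R]_n) : (forall i, 0 <= z i 0) -> (z^T *m z) 0 0 = 1 -> K z^T.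
  move=> z0 z1; split => [i|]; first by rewrite mxE.
  by rewrite -z1 sqnormE; apply: eq_bigr => i _; rewrite mxE.
have [|x] := compact_EVT_min _ (@orthant_sphere_compact R n)
  (continuous_subspaceT (@continuous_tensor_form R m n A)).
  by exists y^T; exact: KT.
move=> /set_mem[x0 x1] xmin; exists x^T; split=> [i||z z0 z1].
- by rewrite mxE.
- by rewrite sqnormE -x1; apply: eq_bigr => i _; rewrite mxE.
- by rewrite -[z]trmxK; apply: xmin; apply: mem_set; exact: KT.
Qed.

(* Comparing [|z| ^+ m] with [(|z| ^+ 2) ^+ m] keeps the bound polynomial in
   [z] even when [m] is odd; the two bounds agree to first order on the sphere
   in tangent directions. *)
Lemma tensor_form_ge (R : realType) (m n : nat) (A : tensor R m n) (mu : R)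
    (z : 'cV[R]_n) : mu <= 0 ->
  (forall w : 'cV[R]_n, (forall i, 0 <= w i 0) -> (w^T *m w) 0 0 = 1 ->
     mu <= tensor_form A w) ->
  (forall i, 0 <= z i 0) -> 1 <= (z^T *m z) 0 0 ->
  mu * (z^T *m z) 0 0 ^+ m <= tensor_form A z.
Proof.
move=> mu0 muP z0; set q := (_ *m _) 0 0 => q1.
pose r := Num.sqrt q.
have q0 : 0 <= q by apply: le_trans q1.
have r2 : r ^+ 2 = q by rewrite sqr_sqrtr.
have r1 : 1 <= r by rewrite -sqrtr1 ler_wsqrtr.
have r0 : 0 < r by apply: lt_le_trans r1.
have zE : z = r *: (r^-1 *: z) by rewrite scalerA divff ?gt_eqF // scale1r.
have muw : mu <= tensor_form A (r^-1 *: z).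
  apply: muP => [i|]; first by rewrite mxE mulr_ge0 // invr_ge0 ltW.
  by rewrite sqnormZ -/q -r2 exprVn mulVf // expf_neq0 // gt_eqF.
rewrite zE tensor_formZ; apply: le_trans (_ : r ^+ m * mu <= _); last first.
  by rewrite ler_wpM2l // exprn_ge0 // ltW.
(* As [r >= 1], [r ^+ m] is at most its square [q ^+ m]; multiplying by [mu <= 0] reverses the
   inequality. *)
by rewrite mulrC ler_wnM2r // -r2 -exprM mulnC exprM ler_eXnr ?exprn_ege1.
Qed.

(** * First-order conditions at a minimiser *)

Lemma min_tangent (R : realType) (m n : nat) (A : tensor R m.+1 n)
    (x v : 'cV[R]_n) : symmetric_tensor A ->
  (forall i, 0 <= x i 0) -> (x^T *m x) 0 0 = 1 -> tensor_form A x <= 0 ->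
  (forall z : 'cV[R]_n, (forall i, 0 <= z i 0) -> (z^T *m z) 0 0 = 1 ->
      tensor_form A x <= tensor_form A z) ->
  (forall i, x i 0 = 0 -> v i 0 = 0) -> \sum_i x i 0 * v i 0 = 0 ->
  \sum_i v i 0 * tensor_app A x i 0 = 0.
Proof.
move=> symA x0 x1 mu0 xmin v0 xv; set mu := tensor_form A x in mu0 xmin.
have [e e0 eP] := pos_radius x0 v0.
set c := \sum_i v i 0 ^+ 2.
have c0 : 0 <= c by apply: sumr_ge0 => i _; exact: sqr_ge0.
have normE t : ((x + t *: v)^T *m (x + t *: v)) 0 0 = 1 + c * t ^+ 2.
  rewrite sqnormE -x1 sqnormE.
  rewrite (eq_bigr (fun i => x i 0 ^+ 2 + (v i 0 ^+ 2 * t ^+ 2 +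
    2 * t * (x i 0 * v i 0)))); last by move=> i _; rewrite !mxE; ring.
  by rewrite !big_split -big_distrl -big_distrr /= xv mulr0 addr0.
(* Orthogonality of [x] and [v] leaves no linear term in the squared norm, so the subtracted power
   has derivative zero at 0 and only the derivative of [line_poly] survives. *)
pose p := line_poly A x v - mu%:P * (1 + c%:P * 'X ^+ 2) ^+ m.+1.
have pE t : p.[t] = tensor_form A (x + t *: v) - mu * (1 + c * t ^+ 2) ^+ m.+1.
  by rewrite /p hornerD hornerN horner_line_poly !hornerE.
have p00 : p.[0] = 0.
  by rewrite pE scale0r addr0 expr0n mulr0 addr0 expr1n mulr1 subrr.
have : p^`().[0] = 0.
  apply: (deriv_horner_local_min e0) => t; rewrite subr0 p00 pE subr_ge0 => te.
  rewrite -normE; apply: tensor_form_ge => //; first exact: eP.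
  by rewrite normE lerDl mulr_ge0 // sqr_ge0.
rewrite /p derivB hornerD hornerN deriv_line_poly // derivM derivC mul0r add0r.
rewrite deriv_exp derivD derivM !derivC mul0r !add0r derivXn.
rewrite !(hornerE, hornerMn) !(mulr0, mul0r, mul0rn, subr0) => /eqP.
by rewrite mulrn_eq0 => /eqP.
Qed.

Lemma min_eigen (R : realType) (m n : nat) (A : tensor R m.+1 n)
    (x : 'cV[R]_n) (i : 'I_n) : symmetric_tensor A ->
  (forall i, 0 <= x i 0) -> (x^T *m x) 0 0 = 1 -> tensor_form A x <= 0 ->
  (forall z : 'cV[R]_n, (forall i, 0 <= z i 0) -> (z^T *m z) 0 0 = 1 ->
      tensor_form A x <= tensor_form A z) ->
  x i 0 != 0 -> tensor_app A x i 0 = tensor_form A x * x i 0.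
Proof.
move=> symA x0 x1 mu0 xmin xi.
(* The [i]-th basis vector minus its projection onto the unit vector [x]. It is orthogonal to [x],
   and it vanishes wherever [x] does because [x i 0 != 0]. *)
pose v := \col_j ((j == i)%:R - x i 0 * x j 0) : 'cV[R]_n.
have sumv (y : 'cV[R]_n) :
    \sum_j v j 0 * y j 0 = y i 0 - x i 0 * \sum_j x j 0 * y j 0.
  rewrite big_distrr /= (eq_bigr (fun j => (j == i)%:R * y j 0 - x i 0 * (x j 0 * y j 0))).
    rewrite big_split /= sumrN (bigD1 i) //= eqxx mul1r big1 ?addr0 // => j.
    by move/negbTE->; rewrite mul0r.
  by move=> j _; rewrite mxE; ring.
have := min_tangent (v := v) symA x0 x1 mu0 xmin.
rewrite sumv -tensor_formE => H; apply/eqP; rewrite -subr_eq0 [_ * x i 0]mulrC H //.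
- move=> j xj; rewrite mxE xj mulr0 subr0.
  by case: eqP => // ji; rewrite -ji xj eqxx in xi.
- under eq_bigr do rewrite mulrC.
  rewrite sumv; under eq_bigr do rewrite -expr2.
  by rewrite -sqnormE x1 mulr1 subrr.
Qed.

Theorem theorem4p4 (R : realType) (m n : nat) (hn : (0 < n)%N)
    (A : tensor R m.+1 n) (hA : symmetric_tensor A) :
  copositive A <->
  (forall N : {set 'I_n}, N != set0 ->
     ~ exists mu : R, mu < 0 /\ Zpp_eigenvalue (principal_subtensor A N) mu).
Proof.
split=> [copA N _ [mu [mu0 [v [v0 [vE v1]]]]]|noneg y y0].
  pose x := extend_vec v.
  have xN j : j \notin N -> x j 0 = 0 by exact: extend_vec_out.
  have vx : restrict_vec N x = v := extend_vecK v.
  have x0 i : 0 <= x i 0.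
    by rewrite mxE; apply: sumr_ge0 => j _; rewrite mulrn_wge0 // ltW.
  have := copA x x0; rewrite tensor_formE (sum_restrict _ xN).
  rewrite -tensor_app_restrict // vx vE.
  under eq_bigr do rewrite mxE mulrCA -expr2.
  by rewrite -big_distrr /= -sqnormE v1 mulr1 leNgt mu0.
rewrite leNgt; apply/negP => Ay.
(* If [y] were zero, the form would vanish at [y], the order being positive; so [y] can be
   normalised. *)
have q0 : 0 < (y^T *m y) 0 0.
  rewrite lt0r sqnormE sumr_ge0 ?andbT => [|i _]; last exact: sqr_ge0.
  apply/eqP => /psumr_eq0P yi.
  move: Ay; rewrite tensor_formE big1 ?ltxx // => i _.
  have /eqP := yi (fun i _ => sqr_ge0 (y i 0)) i isT.
  by rewrite sqrf_eq0 => /eqP ->; rewrite mul0r.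
pose w := (Num.sqrt ((y^T *m y) 0 0))^-1 *: y.
have s0 : 0 < (Num.sqrt ((y^T *m y) 0 0))^-1 by rewrite invr_gt0 sqrtr_gt0.
have w0 i : 0 <= w i 0 by rewrite mxE mulr_ge0 // ltW.
have w1 : (w^T *m w) 0 0 = 1.
  by rewrite sqnormZ exprVn sqr_sqrtr ?ltW // mulVf // gt_eqF.
(* By homogeneity, positive scaling preserves the sign of the form. *)
have Aw : tensor_form A w < 0 by rewrite tensor_formZ pmulr_rlt0 // exprn_gt0.
have [x [x0 x1 xmin]] := tensor_form_min A w0 w1.
have mu0 : tensor_form A x < 0 by apply: le_lt_trans (xmin w w0 w1) Aw.
pose N := [set i | x i 0 != 0].
have xN j : j \notin N -> x j 0 = 0 by rewrite inE negbK => /eqP.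
apply: (noneg N).
  apply/eqP => N0; move: x1; rewrite sqnormE big1 => [/esym/eqP|i _].
    by rewrite oner_eq0.
  by rewrite xN ?expr0n // N0 inE.
exists (tensor_form A x); split => //; exists (restrict_vec N x); split => [i|].
  rewrite mxE lt0r x0 andbT.
  by have := enum_valP i; rewrite inE.
split; last by rewrite sqnorm_restrict.
rewrite tensor_app_restrict //; apply/colP => i.
rewrite mxE min_eigen // ?ltW //; first by rewrite !mxE.
by have := enum_valP i; rewrite inE.
Qed.
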